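(* Let $A$ be a subspace of a unital $C^*$-algebra $B$. Then $A$ is closed under multiplication if and only if for each pair of elements $x \in A$ and $y \in A^*$ with $\Vert y \Vert \leq 1$, there exists an element $z \in A$ such that for all $b \in B$, $$\left\Vert \begin{bmatrix} 0 & y & 1 & 0 \\ 2\cdot 1 & x & z & b \end{bmatrix} \right\Vert = \Vert [\, 2 \cdot 1, \; x, \; z, \; b \,] \Vert.$$
   Context: Here $A^* = \{a^* : a \in A\} \subset B$ is the set of adjoints of elements of $A$, $1$ is the identity of $B$, and the norms are the canonical norms on rectangular matrices over the $C^*$-algebra $B$. By the paper's convention all vector spaces are over $\mathbb{C}$ and all normed (or operator) spaces are complete, so that $A$ is a closed linear subspace. *)

(* Defs.v *)
From HB Require Import structures.
From mathcomp Require Import all_boot all_order all_algebra.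
From mathcomp Require Import all_classical all_reals all_analysis.
From mathcomp Require Import complex.

Set Implicit Arguments.
Unset Strict Implicit.
Unset Printing Implicit Defensive.

Import Order.TTheory GRing.Theory Num.Theory.
Import numFieldNormedType.Exports.

Local Open Scope classical_set_scope.
Local Open Scope ring_scope.
Local Open Scope complex_scope.

(* The product is a field of a record over completeNormedModType, rather than
   being inherited from GRing.Algebra: HB refuses a structure inheriting from
   both the normed and the ring hierarchies, because their only existing join
   is numDomainType.  The ring structure is recovered by the instances below. *)
Record cstarAlgebra (R : realType) := CStarAlgebra {
  cstar_space : completeNormedModType R[i];
  cstar_mul : cstar_space -> cstar_space -> cstar_space;
  cstar_one : cstar_space;
  cstar_adj : cstar_space -> cstar_space;
  cstar_mulA : associative cstar_mul;
  cstar_mul1x : left_id cstar_one cstar_mul;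
  cstar_mulx1 : right_id cstar_one cstar_mul;
  cstar_mulDl : left_distributive cstar_mul +%R;
  cstar_mulDr : right_distributive cstar_mul +%R;
  cstar_scaleAl : forall (k : R[i]) (x y : cstar_space),
    k *: cstar_mul x y = cstar_mul (k *: x) y;
  cstar_scaleAr : forall (k : R[i]) (x y : cstar_space),
    k *: cstar_mul x y = cstar_mul x (k *: y);
  cstar_adjK : involutive cstar_adj;
  cstar_adjD : {morph cstar_adj : x y / x + y};
  cstar_adjZ : forall (k : R[i]) (x : cstar_space),
    cstar_adj (k *: x) = k^* *: cstar_adj x;
  cstar_adjM : forall x y : cstar_space,
    cstar_adj (cstar_mul x y) = cstar_mul (cstar_adj y) (cstar_adj x);
  cstar_normM : forall x y : cstar_space,
    `|cstar_mul x y| <= `|x| * `|y|;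
  cstar_normC : forall x : cstar_space,
    `|cstar_mul (cstar_adj x) x| = `|x| ^+ 2
}.

Definition cstar_sort (R : realType) (B : cstarAlgebra R) : Type :=
  cstar_space B.
Coercion cstar_sort : cstarAlgebra >-> Sortclass.

HB.instance Definition _ (R : realType) (B : cstarAlgebra R) :=
  CompleteNormedModule.copy (cstar_sort B) (cstar_space B).
HB.instance Definition _ (R : realType) (B : cstarAlgebra R) :=
  GRing.Zmodule_isPzRing.Build (cstar_sort B)
    (@cstar_mulA R B) (@cstar_mul1x R B) (@cstar_mulx1 R B)
    (@cstar_mulDl R B) (@cstar_mulDr R B).

Definition star (R : realType) (B : cstarAlgebra R) (x : B) : B :=
  cstar_adj x.

(* Norm of the Hilbert C*-module B^n, whose B-valued inner product is
   <u, v> = \sum_i u_i^* v_i. *)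
Definition colnorm (R : realType) (B : cstarAlgebra R) n (v : 'cV[B]_n) : R :=
  Num.sqrt (complex.Re `|\sum_i star (v i 0) * v i 0|).

(* The canonical norm on 'M_(m, n)(B): the operator norm of X acting from B^n
   to B^m by left multiplication, which for m = n is the unique C*-norm of the
   *-algebra 'M_n(B). *)
Definition mxnorm (R : realType) (B : cstarAlgebra R) m n (X : 'M[B]_(m, n)) :
    R :=
  sup [set colnorm (X *m v) | v in [set v : 'cV[B]_n | colnorm v <= 1]].

Definition mx_of_rows (T : nmodType) m n (rows : seq (seq T)) : 'M[T]_(m, n) :=
  \matrix_(i, j) nth 0 (nth [::] rows i) j.

(* Main.v *)
Require Import Defs.
From HB Require Import structures.
From mathcomp Require Import all_boot all_order all_algebra.
From mathcomp Require Import all_classical all_reals all_analysis.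
From mathcomp Require Import complex ring lra.

Set Implicit Arguments.
Unset Strict Implicit.
Unset Printing Implicit Defensive.

Import Order.TTheory GRing.Theory Num.Theory.
Import numFieldNormedType.Exports.

Local Open Scope classical_set_scope.
Local Open Scope ring_scope.

(** Write X for the two-row matrix, r for its lower row and v* for the adjoint
    of v. The product X X* has diagonal entries 1 + y y* and
    r r* = 4 + x x* + z z* + b b*, and off-diagonal entry x y* + z. The theorem
    comes from the fact that, for nrm y <= 1, the norm of X equals that of r for
    all b exactly when the rows are orthogonal, that is, when z = - x y*. This z
    lies in A for all x in A and y in A* with nrm y <= 1 exactly when A is
    closed under products.

    If z = - x y*, then X X* is diagonal, and 1 + y y* <= 2 <= r r*, so the
    norms of X and r agree ([mxnorm_orthogonal_rows]). If conversely the norms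
    agree for every b, choose b such that r r* is a scalar t. Then r has norm at
    most sqrt t, and the unit vector r* / sqrt t is mapped by X to a vector with
    lower entry sqrt t and upper entry d / sqrt t, where d* = x y* + z. The norm
    of t + d* d / t is at most t only if d = 0 ([mxnorm_eq_orthogonal]).

    Both arguments compare norms of sums of elements v* v, and thus need the
    order of a C*-algebra: the elements v* v are positive, sums of positive
    elements are positive, and the norm is monotone on them. This theory is
    developed from the axioms without spectra or functional calculus. An element
    a is called positive if it is self-adjoint and nrm (t - a) <= t for some
    t >= 0. Square roots of 1 - h with nrm h < 1 come from a contraction
    ([sqrt_oneB]). The norm is monotone because two commuting self-adjoint k, l
    with k^2 + l^2 = r are the real and imaginary parts of an element of norm at
    most sqrt r ([nrm_sum_sq], [nrm_le_positive]). That x* x is positive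
    ([positive_starM]) rests on transferring upper bounds from w* w to w w*
    ([positive_swap]). *)

(** * Norm, involution and real scalars *)

Section CstarBasics.
Variables (R : realType) (B : cstarAlgebra R).
Implicit Types (x y z : B) (r s : R).
Local Open Scope complex_scope.

(** The norm of B takes its values in the complex numbers; all
    estimates below are made on this real version of it. *)
Definition nrm x : R := complex.Re `|x|.

Lemma normE x : `|x| = (nrm x)%:C.
Proof. by rewrite /nrm RRe_real // normr_real. Qed.

Lemma nrm_ge0 x : 0 <= nrm x.
Proof. by rewrite -ler0c -normE normr_ge0. Qed.

Lemma nrm0 : nrm 0 = 0.
Proof. by apply: complexI; rewrite -normE normr0. Qed.

Lemma nrm0_eq0 x : nrm x = 0 -> x = 0.
Proof. by move=> x0; apply/normr0_eq0; rewrite normE x0. Qed.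

Lemma nrmD x y : nrm (x + y) <= nrm x + nrm y.
Proof. by rewrite -lecR rmorphD /= -!normE ler_normD. Qed.

Lemma nrmN x : nrm (- x) = nrm x.
Proof. by apply: complexI; rewrite -!normE normrN. Qed.

Lemma nrmB x y : nrm (x - y) = nrm (y - x).
Proof. by rewrite -nrmN opprB. Qed.

Lemma nrmM x y : nrm (x * y) <= nrm x * nrm y.
Proof. by rewrite -lecR rmorphM /= -!normE; exact: cstar_normM. Qed.

Lemma nrm_starM x : nrm (star x * x) = nrm x ^+ 2.
Proof. by apply: complexI; rewrite rmorphXn /= -!normE; exact: cstar_normC. Qed.

Lemma nrmZ (k : R[i]) x : nrm (k *: x) = complex.Re `|k| * nrm x.
Proof.
by apply: complexI; rewrite rmorphM /= -!normE normrZ normE RRe_real.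
Qed.

Lemma starK : involutive (@star R B).
Proof. exact: cstar_adjK. Qed.

Lemma starD x y : star (x + y) = star x + star y.
Proof. exact: cstar_adjD. Qed.

Lemma starM x y : star (x * y) = star y * star x.
Proof. exact: cstar_adjM. Qed.

Lemma starZ (k : R[i]) x : star (k *: x) = k^* *: star x.
Proof. exact: cstar_adjZ. Qed.

Lemma star0 : star (0 : B) = 0.
Proof. by apply: (addIr (star 0)); rewrite -starD !add0r. Qed.

Lemma starN x : star (- x) = - star x.
Proof. by apply/eqP; rewrite -subr_eq0 opprK -starD addNr star0. Qed.

Lemma starB x y : star (x - y) = star x - star y.
Proof. by rewrite starD starN. Qed.

Lemma star1 : star (1 : B) = 1.
Proof. by rewrite -[LHS]mulr1 -[X in _ * X]starK -starM mulr1 starK. Qed.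

Lemma starX x n : star (x ^+ n) = star x ^+ n.
Proof. by elim: n => [|n IHn]; rewrite ?star1 // exprS starM IHn -exprSr. Qed.

Lemma star_sum I (s : seq I) (F : I -> B) :
  star (\sum_(i <- s) F i) = \sum_(i <- s) star (F i).
Proof. exact: (big_morph _ starD star0). Qed.

(** The C*-identity gives nrm x ^+ 2 <= nrm (star x) * nrm x, hence one
    inequality, and the involution exchanges the two sides. *)
Lemma nrm_star x : nrm (star x) = nrm x.
Proof.
have le_star z : nrm z <= nrm (star z).
  have [->|z0] := eqVneq (nrm z) 0; first exact: nrm_ge0.
  have z_gt0 : 0 < nrm z by rewrite lt_neqAle eq_sym z0 nrm_ge0.
  by rewrite -(ler_pM2r z_gt0) -expr2 -nrm_starM nrmM.
by apply/eqP; rewrite eq_le le_star andbT -{2}[x]starK le_star.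
Qed.

Lemma nrmM_star x : nrm (x * star x) = nrm x ^+ 2.
Proof. by rewrite -{1}[x]starK nrm_starM nrm_star. Qed.

(** The canonical copy of the real numbers inside B, as central self-adjoint
    elements. B being only a ring and a normed module separately, this ring
    morphism is what allows scalars to take part in ring computations. *)
Definition cstar_real r : B := r%:C *: (1 : B).

Local Notation sc := cstar_real.

Lemma scl r x : sc r * x = r%:C *: x.
Proof.
rewrite /cstar_real -[_ * x]cstar_scaleAl; congr (_ *: _).
exact: mul1r.
Qed.

Lemma scr r x : x * sc r = r%:C *: x.
Proof.
rewrite /cstar_real -[x * _]cstar_scaleAr; congr (_ *: _).
exact: mulr1.
Qed.

Lemma scC r x : sc r * x = x * sc r.
Proof. by rewrite scl scr. Qed.

Fact sc_is_additive : additive sc.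
Proof. by move=> r s; rewrite /cstar_real rmorphB scalerBl. Qed.
HB.instance Definition _ := GRing.isAdditive.Build R B sc sc_is_additive.

Fact sc_is_multiplicative : multiplicative sc.
Proof.
split=> [r s|]; last by rewrite /cstar_real rmorph1 scale1r.
by rewrite scl /sc rmorphM scalerA.
Qed.
HB.instance Definition _ :=
  GRing.isMultiplicative.Build R B sc sc_is_multiplicative.

Lemma star_sc r : star (sc r) = sc r.
Proof. by rewrite /cstar_real starZ star1 conj_Creal // complex_real. Qed.

Lemma nrm_scM r x : nrm (sc r * x) = `|r| * nrm x.
Proof. by rewrite scl nrmZ normc_def /= expr0n addr0 sqrtr_sqr. Qed.

(** Equality may fail, as nothing excludes the zero algebra, where 1 = 0. *)
Lemma nrm1_le1 : nrm (1 : B) <= 1.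
Proof.
have : nrm (1 : B) * (nrm (1 : B) - 1) = 0.
  by rewrite mulrBr mulr1 -expr2 -nrm_starM star1 mul1r subrr.
by move/eqP; rewrite mulf_eq0 subr_eq0 => /orP[]/eqP ->; rewrite ?ler01.
Qed.

Lemma nrm_sc r : nrm (sc r) <= `|r|.
Proof. by rewrite -[sc r]mulr1 nrm_scM ler_piMr // nrm1_le1. Qed.

Lemma nrmX x n : nrm (x ^+ n) <= nrm x ^+ n.
Proof.
elim: n => [|n IHn]; first exact: nrm1_le1.
by rewrite !exprS (le_trans (nrmM _ _)) // ler_wpM2l // nrm_ge0.
Qed.

Lemma nrm_sq x : star x = x -> nrm (x ^+ 2) = nrm x ^+ 2.
Proof. by move=> xE; rewrite -nrm_starM xE. Qed.

(** For a self-adjoint x the C*-identity reads nrm (x ^+ 2) = nrm x ^+ 2, so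
    that exact norms of powers are available along the exponents 2 ^ k. This
    takes the place of the spectral radius formula. *)
Lemma nrmX2 x k : star x = x -> nrm (x ^+ (2 ^ k)) = nrm x ^+ (2 ^ k).
Proof.
move=> xE; elim: k => [|k IHk]; first by rewrite !expr1.
by rewrite expnSr !exprM nrm_sq ?IHk // starX xE.
Qed.

(** Completeness of B, in the form in which a fixed point is obtained from an
    iteration: consecutive terms are simultaneously close to the limit, so that
    the recurrence relation passes to it. *)
Lemma geometric_cvg (y : nat -> B) (q C : R) : 0 <= q < 1 ->
  (forall n, nrm (y n.+1 - y n) <= C * q ^+ n) ->
  exists l, forall e, 0 < e ->
    exists n, nrm (y n.+1 - l) < e /\ nrm (y n - l) < e.
Proof.
move=> /andP[q0 q1] y_step.
have q1' : 0 < 1 - q by rewrite subr_gt0.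
have C0 : 0 <= C.
  by apply: le_trans (nrm_ge0 _) _; rewrite -[C]mulr1; exact: (y_step 0%N).
have dist n m : nrm (y (n + m)%N - y n) <= C / (1 - q) * q ^+ n * (1 - q ^+ m).
  elim: m => [|m IHm]; first by rewrite addn0 subrr nrm0 subrr mulr0.
  rewrite addnS -(subrKA (y (n + m)%N)) (le_trans (nrmD _ _)) //.
  rewrite (le_trans (lerD (y_step _) IHm)) // exprD exprS.
  rewrite le_eqVlt; apply/orP; left; apply/eqP; field.
  by rewrite gt_eqF.
have small e : 0 < e ->
    exists N, forall n, (N <= n)%N -> C / (1 - q) * q ^+ n < e.
  move=> e0.
  have q1n : `|q| < 1 by rewrite ger0_norm.
  have /cvgrPdist_lt /(_ e e0) [N _ HN] := cvg_geometric (C / (1 - q)) q1n.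
  exists N => n Nn; have := HN n Nn.
  rewrite /= sub0r normrN ger0_norm // mulr_ge0 ?exprn_ge0 //.
  by rewrite divr_ge0 // ltW.
have dist' n m : nrm (y (n + m)%N - y n) <= C / (1 - q) * q ^+ n.
  rewrite (le_trans (dist n m)) // ler_piMr //; last first.
    by rewrite gerBl exprn_ge0.
  by rewrite mulr_ge0 ?exprn_ge0 // divr_ge0 // ltW.
have cv : cvgn (y : nat -> cstar_space B).
  apply/cauchy_cvgP; apply/cauchy_exP => e e0.
  have eE : e = (complex.Re e)%:C by rewrite RRe_real // gtr0_real.
  have e0' : 0 < complex.Re e by rewrite -ltcR -eE.
  have [N HN] := small _ e0'.
  exists (y N); exists N => // n /= Nn.
  rewrite -ball_normE /= eE -[`|_|]/(`|(y N - y n : B)|) normE ltcR nrmB.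
  by rewrite -(subnKC Nn) (le_lt_trans (dist' _ _)) // HN.
exists (limn (y : nat -> cstar_space B)) => e e0.
have e0c : (0 : R[i]) < e%:C by rewrite ltcR.
have /cvgrPdist_lt /(_ _ e0c) [N _ HN] := cv.
have near m : (N <= m)%N -> nrm (y m - limn (y : nat -> cstar_space B)) < e.
  by move=> Nm; rewrite nrmB -ltcR -normE; exact: HN.
by exists N; split; apply: near.
Qed.

End CstarBasics.

(** * Square roots and the positive cone *)

Section Positivity.
Variables (R : realType) (B : cstarAlgebra R).
Implicit Types (a b c h k l x y : B) (e r t T : R).
Local Notation sc := (@cstar_real R B).

Lemma small_eq0 x K : (forall e, 0 < e -> nrm x <= K * e) -> x = 0.
Proof.
move=> xe; apply: nrm0_eq0; apply/eqP; rewrite eq_le nrm_ge0 andbT.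
apply/ler_addgt0Pr => e e0; rewrite add0r.
have K0 : 0 < `|K| + 1 by rewrite ltr_pwDr.
have d0 : 0 < e / (`|K| + 1) by rewrite divr_gt0.
rewrite (le_trans (xe _ d0)) // (mulrC e) mulrA ler_piMl ?(ltW e0) //.
by rewrite ler_pdivrMr // mul1r (le_trans (ler_norm K)) // lerDl.
Qed.

(** Writing k = 1 - l, the equation k ^+ 2 = 1 - h becomes l = (h + l ^+ 2) / 2.
    The map on the right preserves the ball of radius nrm h and is
    (nrm h)-Lipschitz there, so its iterates from 0 converge. They are
    polynomials in h, hence are self-adjoint and commute with the commutant of
    h, and both properties pass to the limit. *)
Lemma sqrt_oneB h : star h = h -> nrm h < 1 ->
  exists k, [/\ star k = k, k ^+ 2 = 1 - h &
    forall c, c * h = h * c -> c * k = k * c].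
Proof.
move=> hE h1; pose f y := sc 2^-1 * (h + y ^+ 2).
pose y n := iter n f 0.
have fB a b : nrm (f a - f b) <= 2^-1 * ((nrm a + nrm b) * nrm (a - b)).
  have -> : f a - f b = sc 2^-1 * (a * (a - b) + (a - b) * b).
    rewrite /f -mulrBr; congr (_ * _).
    by rewrite mulrBr mulrBl addrA subrK !expr2 opprD addrACA subrr add0r.
  rewrite nrm_scM ger0_norm // ler_wpM2l // (le_trans (nrmD _ _)) //.
  by rewrite [leRHS]mulrDl lerD ?nrmM // mulrC nrmM.
have yq n : nrm (y n) <= nrm h.
  elim: n => [|n IHn]; first by rewrite nrm0 nrm_ge0.
  rewrite /= nrm_scM ger0_norm //; have := nrmD h (y n ^+ 2).
  by have := nrmX (y n) 2; have := nrm_ge0 (y n); nra.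
have [||l Hl] := @geometric_cvg _ _ y (nrm h) (nrm h).
- by rewrite nrm_ge0.
- elim=> [|n IHn].
    rewrite /= subr0 /f expr0n addr0 nrm_scM ger0_norm // mulr1.
    by rewrite ler_piMl ?nrm_ge0 // invf_le1 // ler1n.
  rewrite (le_trans (fB _ _)) // exprS mulrCA.
  apply: (@le_trans _ _ (nrm h * nrm (y n.+1 - y n))).
    by have := nrm_ge0 (y n.+1 - y n); have := yq n; have := yq n.+1; nra.
  by rewrite ler_wpM2l ?nrm_ge0.
have l_fix : l - f l = 0.
  apply: (@small_eq0 _ (1 + nrm h + nrm l)) => e e0.
  have [n [yl1 yl]] := Hl _ e0.
  rewrite -(subrKA (y n.+1)) (le_trans (nrmD _ _)) // nrmB.
  have := fB (y n) l; have := yq n; have := nrm_ge0 l.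
  have := nrm_ge0 (y n - l); have := nrm_ge0 (y n).
  by move: yl yl1; rewrite /= -/(y n); nra.
have starf n : star (y n) = y n.
  elim: n => [|n IHn]; first exact: star0.
  by rewrite /= starM star_sc starD starX IHn hE -scC.
exists (1 - l); split.
- rewrite starB star1; congr (_ - _); apply/eqP; rewrite -subr_eq0; apply/eqP.
  apply: (@small_eq0 _ 2) => e e0; have [n [_ yl]] := Hl _ e0.
  rewrite -(subrKA (y n)) (le_trans (nrmD _ _)) // -{1}starf -starB nrm_star.
  by rewrite nrmB; lra.
- have l2 : l *+ 2 = h + l ^+ 2.
    rewrite {1}(subr0_eq l_fix) /f -mulrnAl -rmorphMn /= -mulr_natr.
    by rewrite mulVf ?rmorph1 ?mul1r // pnatr_eq0.
  have -> : h = l + (l - l ^+ 2).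
    by rewrite addrA -mulr2n l2 addrK.
  rewrite expr2 mulrBl mul1r mulrBr mulr1 -expr2 [in RHS]opprD.
  by rewrite [RHS]addrA.
- move=> c ch; rewrite mulrBr mulrBl mulr1 mul1r; congr (_ - _).
  have cy n : c * y n = y n * c.
    elim: n => [|n IHn]; first by rewrite mulr0 mul0r.
    rewrite /= /f mulrA -scC -!mulrA mulrDr mulrDl ch; congr (_ * (_ + _)).
    by rewrite expr2 mulrA IHn -mulrA IHn mulrA.
  apply/eqP; rewrite -subr_eq0; apply/eqP.
  apply: (@small_eq0 _ (nrm c + nrm c)) => e e0; have [n [_ yl]] := Hl _ e0.
  rewrite -(subrKA (c * y n)) {2}cy -mulrBr -mulrBl.
  rewrite (le_trans (nrmD _ _)) // [leRHS]mulrDl lerD //;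
    rewrite (le_trans (nrmM _ _)) //.
    by rewrite ler_wpM2l ?nrm_ge0 // nrmB ltW.
  by rewrite mulrC ler_wpM2l ?nrm_ge0 // ltW.
Qed.

Lemma cstar_scalerAl (z : R[i]) x y : (z *: x) * y = z *: (x * y).
Proof. exact/esym/cstar_scaleAl. Qed.

Lemma cstar_scalerAr (z : R[i]) x y : x * (z *: y) = z *: (x * y).
Proof. exact/esym/cstar_scaleAr. Qed.

(** The element u = k + i l is normal with star u * u = r, hence has norm at
    most the square root of r, and k is its real part. *)
Lemma nrm_sum_sq k l r : star k = k -> star l = l -> k * l = l * k ->
  k ^+ 2 + l ^+ 2 = sc r -> 0 <= r -> nrm k ^+ 2 <= r.
Proof.
move=> kE lE kl klr r0; pose u := k + 'i *: l.
have uE : star u = k - 'i *: l.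
  by rewrite /u starD starZ conjCi kE lE scaleNr.
have u2 : nrm u ^+ 2 <= r.
  rewrite -nrm_starM uE /u mulrDr !mulrBl !cstar_scalerAl !cstar_scalerAr kl.
  rewrite addrA subrK scalerA -['i * 'i]expr2 sqrCi scaleN1r opprK -!expr2 klr.
  by rewrite (le_trans (nrm_sc _ _)) // ger0_norm.
apply: le_trans u2; rewrite ler_sqr ?nnegrE ?nrm_ge0 //.
have : nrm (u + star u) = 2 * nrm k.
  rewrite uE addrACA subrr addr0 -[k]mul1r -mulrDl -(rmorph1 sc) -rmorphD.
  by rewrite !nrm_scM normr1 mul1r ger0_norm.
by have := nrmD u (star u); rewrite nrm_star; lra.
Qed.

(** For a self-adjoint a with spectrum in [0, +oo[, the number nrm (t - a) is at
    most t as soon as t >= nrm a, and conversely. Taking this as the definition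
    dispenses with spectra, and makes stability under sums obvious. *)
Definition positive a :=
  star a = a /\ exists2 t, 0 <= t & nrm (sc t - a) <= t.

Lemma positive_sa a : positive a -> star a = a. Proof. by case. Qed.

Lemma positiveD a b : positive a -> positive b -> positive (a + b).
Proof.
move=> [aE [s s0 sa]] [bE [t t0 tb]]; split; first by rewrite starD aE bE.
exists (s + t); first exact: addr_ge0.
by rewrite rmorphD opprD addrACA (le_trans (nrmD _ _)) // lerD.
Qed.

Lemma positive_scM r a : 0 <= r -> positive a -> positive (sc r * a).
Proof.
move=> r0 [aE [t t0 ta]]; split; first by rewrite starM star_sc aE scC.
exists (r * t); first exact: mulr_ge0.
by rewrite rmorphM -mulrBr nrm_scM ger0_norm // ler_wpM2l.
Qed.

Lemma positive_sc r : 0 <= r -> positive (sc r).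
Proof.
by move=> r0; split; [exact: star_sc | exists r; rewrite ?subrr ?nrm0].
Qed.

Lemma positive_scB h T : star h = h -> nrm h <= T -> positive (sc T - h).
Proof.
move=> hE hT; split; first by rewrite starB star_sc hE.
by exists T; rewrite ?subKr // (le_trans (nrm_ge0 h)).
Qed.

(** The shift by e brings the argument strictly inside the domain of the
    square root: a + e = (t + e) (1 - h) with nrm h <= t / (t + e) < 1. *)
Lemma positive_sqrt a e : positive a -> 0 < e ->
  exists k, [/\ star k = k, k ^+ 2 = a + sc e &
    forall c, c * a = a * c -> c * k = k * c].
Proof.
move=> [aE [t t0 ta]] e0; have T0 : 0 < t + e by rewrite ltr_wpDl.
pose h := sc (t + e)^-1 * (sc t - a).
have hE : star h = h by rewrite /h starM starB !star_sc aE scC.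
have h1 : nrm h < 1.
  rewrite nrm_scM gtr0_norm ?invr_gt0 // mulrC ltr_pdivrMr // mul1r.
  by rewrite (le_lt_trans ta) // ltrDl.
have [k [kE k2 kc]] := sqrt_oneB hE h1.
exists (sc (Num.sqrt (t + e)) * k); split.
- by rewrite starM star_sc kE scC.
- rewrite exprMn_comm; last exact: scC.
  rewrite -rmorphXn /= sqr_sqrtr ?ltW // k2 mulrBr mulr1 /h mulrA -rmorphM.
  by rewrite mulfV ?gt_eqF // rmorph1 mul1r rmorphD opprB addrC addrA subrK.
- move=> c ca; rewrite mulrA -scC -!mulrA kc // /h mulrA -(scC _ c) -!mulrA.
  by congr (_ * _); rewrite mulrBr mulrBl ca scC.
Qed.

(** Both a + e and T - a + e have self-adjoint square roots, which commute, and
    their squares add up to a scalar close to T. *)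
Lemma nrm_le_positive a T : 0 <= T -> positive a -> positive (sc T - a) ->
  nrm a <= T.
Proof.
move=> T0 a0 Ta; apply/ler_addgt0Pr => e e0.
have e30 : 0 < e / 3 by rewrite divr_gt0.
have [k [kE k2 kc]] := positive_sqrt a0 e30.
have [l [lE l2 lc]] := positive_sqrt Ta e30.
have ka : k * a = a * k by rewrite kc.
have kl : k * l = l * k by apply: lc; rewrite mulrBr mulrBl ka scC.
have : nrm k ^+ 2 <= T + e / 3 + e / 3.
  apply: (nrm_sum_sq kE lE kl); last by lra.
  by rewrite k2 l2 addrC addrACA subrK addrA -!rmorphD.
rewrite -nrm_sq // k2; have := nrmB (a + sc (e / 3)) (sc (e / 3)).
have := nrmD (a + sc (e / 3)) (- sc (e / 3)); rewrite addrK nrmN.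
by have := nrm_sc B (e / 3); rewrite ger0_norm; lra.
Qed.

Lemma nrm_le_positiveD a b : positive a -> positive b -> nrm a <= nrm (a + b).
Proof.
move=> a0 b0; apply: (nrm_le_positive _ a0); first exact: nrm_ge0.
have -> : sc (nrm (a + b)) - a = sc (nrm (a + b)) - (a + b) + b.
  by rewrite opprD addrA subrK.
apply: (positiveD _ b0); apply: positive_scB => //.
by rewrite starD !positive_sa.
Qed.

(** After scaling, nrm k < 1 and 1 - k ^+ 2 = l ^+ 2, where l ^+ 2 + k ^+ 2 = 1
    forces nrm (l ^+ 2) <= 1. *)
Lemma positive_sq k : star k = k -> positive (k ^+ 2).
Proof.
move=> kE; split; first by rewrite starX kE.
pose T := nrm k ^+ 2 + 1.
have T0 : 0 < T by rewrite ltr_wpDl ?sqr_ge0.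
exists T; first exact: ltW.
pose h := sc T^-1 * k ^+ 2.
have hE : star h = h by rewrite /h starM star_sc starX kE scC.
have h1 : nrm h < 1.
  rewrite nrm_scM gtr0_norm ?invr_gt0 // mulrC ltr_pdivrMr // mul1r nrm_sq //.
  by rewrite ltrDl.
have [l [lE l2 lc]] := sqrt_oneB hE h1.
pose k' := sc (Num.sqrt T)^-1 * k.
have k'2 : k' ^+ 2 = h.
  rewrite exprMn_comm; last exact: scC.
  by rewrite -rmorphXn /= exprVn sqr_sqrtr // ltW.
have -> : sc T - k ^+ 2 = sc T * (1 - h).
  by rewrite mulrBr mulr1 mulrA -rmorphM mulfV ?gt_eqF // rmorph1 mul1r.
rewrite nrm_scM gtr0_norm // ler_piMr ?(ltW T0) // -l2 nrm_sq //.
apply: (@nrm_sum_sq l k' 1) => //.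
- by rewrite /k' starM star_sc kE scC.
- apply/esym/lc; rewrite -k'2 -exprS -exprSr //.
- by rewrite l2 k'2 subrK rmorph1.
Qed.

End Positivity.

(** * Growth of real sequences *)

Section RealGrowth.
Variable R : realType.
Implicit Types c d g m : R.

Lemma le0_bounded_pow2 c m : (forall k, c * (2 ^ k)%:R <= m) -> c <= 0.
Proof.
move=> cm; rewrite leNgt; apply/negP => c0.
have := cm (Num.truncn (m / c)).+1; rewrite mulrC -ler_pdivlMr // leNgt.
apply/negP; rewrite negbK (lt_le_trans (truncnS_gt _)) // ler_nat.
by rewrite ltnW // ltn_expl.
Qed.

Lemma bernoulli_ineq c n : 0 <= c -> 1 + n%:R * c <= (1 + c) ^+ n.
Proof.
move=> c0; elim: n => [|n IHn]; first by rewrite mul0r addr0.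
rewrite exprS (le_trans _ (ler_wpM2l _ IHn)) ?addr_ge0 // -natr1.
have : 0 <= n%:R * c * c by rewrite !mulr_ge0.
by nra.
Qed.

(** If d < e < g, dividing by e ^+ n, with n + 1 = 2 ^ k, gives
    (g - m) * (g / e) ^+ n <= m, where the left side is unbounded because
    m <= d < g. *)
Lemma pow2_dominated m d g : 0 <= m -> m <= d ->
  (forall k, g ^+ (2 ^ k) <= m * d ^+ (2 ^ k).-1 + m * g ^+ (2 ^ k).-1) ->
  g <= d.
Proof.
move=> m0 md gE; rewrite leNgt; apply/negP => dg.
(* A midpoint instead of d itself, since d may vanish. *)
pose e := (d + g) / 2; have e0 : 0 < e by rewrite /e; lra.
have de : d < e by rewrite /e; lra.
have eg : e < g by rewrite /e; lra.
have r0 : 0 < g / e - 1 by rewrite subr_gt0 ltr_pdivlMr // mul1r.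
suff : (g - m) * (g / e - 1) <= 0.
  by rewrite leNgt mulr_gt0 // subr_gt0 (le_lt_trans md).
apply: (@le0_bounded_pow2 _ (m + (g - m) * (g / e - 1))) => k.
set n := (2 ^ k).-1; have nE : (2 ^ k)%N = n.+1 by rewrite prednK // expn_gt0.
have : (g - m) * (g / e) ^+ n <= m.
  have := gE k; rewrite -/n nE exprS => gn.
  have dn : m * d ^+ n <= m * e ^+ n.
    by rewrite ler_wpM2l // lerXn2r ?nnegrE ?(ltW e0) ?(le_trans m0) // ltW.
  rewrite expr_div_n mulrA ler_pdivrMr ?exprn_gt0 //.
  by rewrite mulrBl; lra.
have := bernoulli_ineq n (ltW r0); rewrite addrCA subrr addr0 => bn gm.
have gm0 : 0 <= g - m by rewrite subr_ge0 ltW // (le_lt_trans md).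
have := le_trans (ler_wpM2l gm0 bn) gm; rewrite nE -natr1.
by lra.
Qed.

End RealGrowth.

(** * Positivity of star x * x *)

Section SquarePositivity.
Variables (R : realType) (B : cstarAlgebra R).
Implicit Types (g h k l s w x y : B) (d r : R).
Local Notation sc := (@cstar_real R B).

(** The elements star w * w and w * star w have the same nonzero spectrum, so an
    upper bound d >= 0 of one bounds the other. Without spectra: shift both by
    M = nrm w ^+ 2 into positive elements g' and g, and compare the growth of
    their powers through w * g' ^+ n = g ^+ n * w. *)
Lemma positive_swap w d : 0 <= d -> positive (sc d - star w * w) ->
  positive (sc d - w * star w).
Proof.
move=> d0 dw; pose M := nrm w ^+ 2.
have M0 : 0 <= M by exact: sqr_ge0.
pose g' := star w * w + sc M; pose g := w * star w + sc M.
have gE : star g = g by rewrite /g starD star_sc starM starK.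
have g'0 : positive g'.
  rewrite /g' addrC -[star w * w]opprK; apply: positive_scB.
    by rewrite starN starM starK.
  by rewrite nrmN nrm_starM.
have g'D : nrm g' <= d + M.
  apply: nrm_le_positive => //; first exact: addr_ge0.
  by rewrite /g' rmorphD opprD addrACA subrr addr0.
have wg n : w * g' ^+ n = g ^+ n * w.
  elim: n => [|n IHn]; first by rewrite mulr1 mul1r.
  rewrite !exprS mulrA (_ : w * g' = g * w); first by rewrite -!mulrA IHn.
  by rewrite /g' /g mulrDr mulrDl mulrA scC.
have gM n : nrm (g ^+ n.+1) <= M * (d + M) ^+ n + M * nrm g ^+ n.
  rewrite exprSr {2}/g mulrDr mulrA -wg -scC.
  rewrite (le_trans (nrmD _ _)) // lerD //; last first.
    by rewrite nrm_scM ger0_norm // ler_wpM2l // nrmX.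
  rewrite (le_trans (nrmM _ _)) // nrm_star /M expr2 mulrAC.
  rewrite ler_wpM2r ?nrm_ge0 // (le_trans (nrmM _ _)) //.
  rewrite ler_wpM2l ?nrm_ge0 // (le_trans (nrmX _ _)) //.
  by rewrite lerXn2r ?nnegrE ?nrm_ge0 // (le_trans (nrm_ge0 g')).
have : nrm g <= d + M.
  apply: (pow2_dominated M0) => [|k]; first by rewrite lerDr.
  by rewrite -nrmX2 // -{1}[(2 ^ k)%N]prednK ?expn_gt0 // gM.
move=> /(positive_scB gE); rewrite /g rmorphD opprD addrACA subrr addr0 //.
Qed.

(** Up to the factor 2 this is the sum of the squares of the self-adjoint
    elements y + star y and i (y - star y). *)
Lemma positive_sym y : positive (star y * y + y * star y).
Proof.
pose p := y + star y; pose q := 'i *: (y - star y).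
have pE : star p = p by rewrite /p starD starK addrC.
have qE : star q = q.
  by rewrite /q starZ conjCi starB starK scaleNr -scalerN opprB.
have -> : star y * y + y * star y = sc 2^-1 * (p ^+ 2 + q ^+ 2).
  have -> : p ^+ 2 + q ^+ 2 = (star y * y + y * star y) *+ 2.
    have p2 : p ^+ 2 = y * y + y * star y + (star y * y + star y * star y).
      by rewrite expr2 /p mulrDl !mulrDr.
    have q2 : q ^+ 2 = star y * y - star y * star y + (y * star y - y * y).
      rewrite expr2 /q cstar_scalerAl cstar_scalerAr scalerA -['i * 'i]expr2.
      by rewrite sqrCi scaleN1r mulrBl !mulrBr !opprB.
    rewrite p2 q2 [X in _ + X = _]addrC addrACA [y * y + _]addrC.
    rewrite [X in X + _ = _]addrACA subrr addr0 [X in _ + X = _]addrACA subrr.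
    by rewrite addr0 addrC mulrnDl !mulr2n.
  rewrite mulrnAr -mulrnAl -rmorphMn /= -mulr_natr mulVf ?pnatr_eq0 //.
  by rewrite rmorph1 mul1r.
apply: positive_scM; first by rewrite invr_ge0.
by apply: positiveD; apply: positive_sq.
Qed.

Lemma positiveMn x n : positive x -> positive (x *+ n).
Proof.
move=> x0; elim: n => [|n IHn]; last by rewrite mulrS; exact: positiveD.
by rewrite mulr0n -(rmorph0 sc); exact: positive_sc.
Qed.

(** The scalar inequality t ^ n (1 - t) <= 1 / (n + 1) for t >= 0, at
    t = s ^+ 2. With d_j = t ^ j - t ^ (j + 1), it follows from the telescoping
    sum d_0 + ... + d_n = 1 - t ^ (n + 1) and from d_j - d_(j + 1) =
    t ^ j (1 - t) ^ 2 >= 0. Each difference is a square of a self-adjoint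
    polynomial in s. *)
Lemma positive_bernoulli s n : star s = s ->
  positive (sc n.+1%:R^-1 - ((s ^+ 2) ^+ n - (s ^+ 2) ^+ n.+1)).
Proof.
move=> sE; set g := s ^+ 2; pose d j := g ^+ j - g ^+ j.+1.
have gE j : g ^+ j = (s ^+ j) ^+ 2 by rewrite /g -!exprM mulnC.
have step : positive (1 - g ^+ n.+1 - d n *+ n.+1).
  elim: n => [|n IHn].
    by rewrite /d expr0 expr1 subrr -(rmorph0 sc); exact: positive_sc.
  have -> : 1 - g ^+ n.+2 - d n.+1 *+ n.+2 =
      1 - g ^+ n.+1 - d n *+ n.+1 + (d n - d n.+1) *+ n.+1.
    rewrite [X in _ = _ + X]mulrnBl [RHS]addrA subrK [X in _ - X = _]mulrS.
    by rewrite [X in _ + X = _]opprD addrA /d opprB addrA subrK.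
  apply: positiveD => //; apply: positiveMn.
  have -> : d n - d n.+1 = (s ^+ n * (1 - g)) ^+ 2.
    rewrite exprMn_comm; last first.
      by rewrite /GRing.comm /g mulrBr mulrBl mulr1 mul1r -!exprD addnC.
    rewrite -gE expr2 mulrA mulrBr mulr1 (mulrBr (g ^+ n)) mulr1 -exprSr.
    by rewrite mulrBl -!exprSr.
  apply: positive_sq; rewrite starM starB star1 !starX sE.
  by rewrite /g mulrBr mulrBl mulr1 mul1r -!exprD addnC.
have step2 : positive (1 - d n *+ n.+1).
  have -> : 1 - d n *+ n.+1 = 1 - g ^+ n.+1 - d n *+ n.+1 + g ^+ n.+1.
    by rewrite addrAC subrK.
  by apply: positiveD => //; rewrite gE; apply: positive_sq; rewrite starX sE.
have -> : sc n.+1%:R^-1 - (g ^+ n - g ^+ n.+1)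
    = sc n.+1%:R^-1 * (1 - d n *+ n.+1).
  have vn : n.+1%:R^-1 *+ n.+1 = 1 :> R by rewrite -[LHS]mulr_natr mulVf.
  by rewrite mulrBr mulr1 mulrnAr -mulrnAl -rmorphMn /= vn rmorph1 mul1r.
by apply: positive_scM; rewrite ?invr_ge0.
Qed.

(** The theorem of Fukamiya, Kelley and Vaught. When nrm x < 1, write
    1 - star x * x = g = s ^+ 2; the claim is that nrm g <= 1. The element
    y = x * s ^+ n satisfies star y * y = g ^+ n - g ^+ n.+1, which is at most
    1 / (n + 1); by [positive_swap] so is y * star y, and [positive_sym] then
    bounds star y * y from below by - 1 / (n + 1). Hence
    nrm (g ^+ n.+1) <= nrm (g ^+ n) + 3 / (n + 1), and if nrm g > 1 the powers
    n + 1 = 2 ^ k contradict this for k large. *)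
Lemma positive_starM x : positive (star x * x).
Proof.
wlog x1 : x / nrm x < 1 => [small|].
  pose c := nrm x + 1; have c0 : 0 < c by rewrite ltr_wpDl ?nrm_ge0.
  have -> : star x * x
      = sc (c ^+ 2) * (star (sc c^-1 * x) * (sc c^-1 * x)).
    rewrite starM star_sc -scC -!mulrA (mulrA (star x)) -scC !mulrA.
    rewrite -!rmorphM /=.
    have -> : c ^+ 2 * c^-1 * c^-1 = 1 by field; rewrite gt_eqF.
    by rewrite rmorph1 mul1r.
  apply: positive_scM; first exact: sqr_ge0.
  apply: small; rewrite nrm_scM gtr0_norm ?invr_gt0 // mulrC.
  by rewrite ltr_pdivrMr // mul1r ltrDl.
pose h := star x * x.
have hE : star h = h by rewrite /h starM starK.
have h1 : nrm h < 1 by rewrite nrm_starM exprn_ilt1 // nrm_ge0.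
have [s [sE s2 _]] := sqrt_oneB hE h1.
suff G1 : nrm (s ^+ 2) <= 1.
  split=> //; exists 1 => //.
  by rewrite rmorph1 -/h -s2.
(* The constant 3 collects 2 / (n + 1) from the two-sided bound on
   star y * y + 1 / (n + 1) and 1 / (n + 1) from undoing the shift. *)
have key n : nrm ((s ^+ 2) ^+ n - (s ^+ 2) ^+ n.+1) <= 3 / n.+1%:R.
  pose y := x * s ^+ n.
  have yE : star y * y = (s ^+ 2) ^+ n - (s ^+ 2) ^+ n.+1.
    rewrite /y starM starX sE mulrA -(mulrA _ (star x)) -/h.
    have -> : h = 1 - s ^+ 2 by rewrite s2 subKr.
    rewrite mulrBr mulr1 mulrBl -!exprD -!exprM.
    by rewrite mulnSr mul2n -addnn addnAC.
  have v0 : 0 <= n.+1%:R^-1 :> R by rewrite invr_ge0.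
  have yP := positive_bernoulli n sE; rewrite -yE in yP *.
  have yP' := positive_swap v0 yP.
  have : nrm (sc n.+1%:R^-1 + star y * y) <= 2 / n.+1%:R.
    apply: nrm_le_positive; first exact: mulr_ge0.
      have := positiveD (positive_sym y) yP'.
      by rewrite addrACA subrr addr0 addrC.
    by rewrite mulrDl mul1r rmorphD opprD addrA addrK.
  have := nrmD (sc n.+1%:R^-1 + star y * y) (- sc n.+1%:R^-1).
  rewrite addrAC subrr add0r nrmN; have := nrm_sc B n.+1%:R^-1.
  rewrite ger0_norm //; set v : R := n.+1%:R^-1.
  by move: v (nrm _) => v u; lra.
set g := s ^+ 2 in key *; rewrite leNgt; apply/negP => G1.
have := subr_gt0 1 (nrm g); rewrite G1 ltNge => /negP; apply.
apply: (@le0_bounded_pow2 _ _ 3) => k.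
rewrite -ler_pdivlMr ?ltr0n ?expn_gt0 //.
have gE : star g = g by rewrite starX sE.
have nE := prednK (expn_gt0 2 k).
rewrite -[(2 ^ k)%N]nE; set n := _.-1 in nE *.
apply: le_trans (key n).
have : nrm (g ^+ n.+1) <= nrm (g ^+ n) + nrm (g ^+ n - g ^+ n.+1).
  by rewrite nrmB -{1}(subrK (g ^+ n) (g ^+ n.+1)) addrC nrmD.
rewrite nE nrmX2 // -nE exprS => GG.
have := nrmX g n; have : 1 <= nrm g ^+ n by rewrite exprn_ege1 ?ltW.
by nra.
Qed.

End SquarePositivity.

(** * The inner product on columns and the norm of matrices *)

Section HilbertModule.
Variables (R : realType) (B : cstarAlgebra R).
Implicit Types (r t : R).
Local Notation sc := (@cstar_real R B).

(** The B-valued inner product whose associated norm is [colnorm]. *)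
Definition ip n (u v : 'cV[B]_n) : B := \sum_i star (u i 0) * v i 0.

Definition adjmx m n (X : 'M[B]_(m, n)) : 'M[B]_(n, m) :=
  \matrix_(i, j) star (X j i).

Lemma colnormE n (v : 'cV[B]_n) : colnorm v = Num.sqrt (nrm (ip v v)).
Proof. by []. Qed.

Lemma ipBl n (u u' v : 'cV[B]_n) : ip (u - u') v = ip u v - ip u' v.
Proof.
rewrite /ip -sumrB; apply: eq_bigr => i _.
by rewrite !mxE starB mulrBl.
Qed.

Lemma ipBr n (u v v' : 'cV[B]_n) : ip u (v - v') = ip u v - ip u v'.
Proof.
by rewrite /ip -sumrB; apply: eq_bigr => i _; rewrite !mxE mulrBr.
Qed.

Lemma ipZl n r (u v : 'cV[B]_n) : ip (sc r *: u) v = sc r * ip u v.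
Proof.
rewrite /ip mulr_sumr; apply: eq_bigr => i _.
by rewrite !mxE starM star_sc -scC mulrA.
Qed.

Lemma ipZr n r (u v : 'cV[B]_n) : ip u (sc r *: v) = sc r * ip u v.
Proof.
rewrite /ip mulr_sumr; apply: eq_bigr => i _.
by rewrite !mxE !mulrA scC.
Qed.

Lemma star_ip n (u v : 'cV[B]_n) : star (ip u v) = ip v u.
Proof.
by rewrite /ip star_sum; apply: eq_bigr => i _; rewrite starM starK.
Qed.

Lemma ip_mull m n (X : 'M[B]_(m, n)) u v : ip (X *m u) v = ip u (adjmx X *m v).
Proof.
rewrite /ip.
under eq_bigr do rewrite mxE star_sum mulr_suml.
rewrite exchange_big /=; apply: eq_bigr => j _.
rewrite mxE mulr_sumr; apply: eq_bigr => i _.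
by rewrite mxE starM mulrA.
Qed.

Lemma ip_mulr m n (X : 'M[B]_(m, n)) u v : ip u (X *m v) = ip (adjmx X *m u) v.
Proof. by rewrite -star_ip ip_mull star_ip. Qed.

Lemma mulmx_scZ m n p r (X : 'M[B]_(m, n)) (Y : 'M[B]_(n, p)) :
  X *m (sc r *: Y) = sc r *: (X *m Y).
Proof.
apply/matrixP => i j; rewrite !mxE mulr_sumr; apply: eq_bigr => k _.
by rewrite !mxE !mulrA scC.
Qed.

Lemma positive_sum I (s : seq I) (P : pred I) (F : I -> B) :
  (forall i, P i -> positive (F i)) -> positive (\sum_(i <- s | P i) F i).
Proof.
move=> F0; apply: (big_ind (@positive R B)) => //; last exact: positiveD.
by rewrite -(rmorph0 sc); exact: positive_sc.
Qed.

Lemma positive_ip n (v : 'cV[B]_n) : positive (ip v v).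
Proof. by apply: positive_sum => i _; exact: positive_starM. Qed.

(** The operator inequality adjmx X * X <= t follows from X * adjmx X <= t
    because, for w = t v - adjmx X X v, the hypothesis gives
    <w, w> + <S X v, S X v> = t (t <v, v> - <X v, X v>),
    whose left side is positive. Asking for an explicit factorisation of
    t - X * adjmx X avoids any notion of positive matrix. *)
Lemma nrm_ip_mulmx m n p (X : 'M[B]_(m, n)) (S : 'M[B]_(p, m)) t v :
  0 < t -> X *m adjmx X + adjmx S *m S = (sc t)%:M ->
  nrm (ip (X *m v) (X *m v)) <= t * nrm (ip v v).
Proof.
move=> t0 XS; set a := X *m v.
pose u := adjmx X *m a; pose w := sc t *: v - u.
have uv : ip u v = ip a a by rewrite -ip_mulr.
have vu : ip v u = ip a a by rewrite -star_ip uv star_ip.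
have uu : ip u u = sc t * ip a a - ip (S *m a) (S *m a).
  rewrite {1}/u -ip_mulr /u mulmxA -(addrK (adjmx S *m S) (X *m _)) XS.
  by rewrite mulmxBl mul_scalar_mx ipBr ipZr -mulmxA ip_mull.
have wE : ip w w + ip (S *m a) (S *m a) = sc t * (sc t * ip v v - ip a a).
  rewrite /w ipBl !ipBr !ipZl !ipZr uv vu uu subKr subrK.
  by rewrite [RHS]mulrBr.
have a_le : ip v v * sc t = ip a a + sc t^-1 * (ip w w + ip (S *m a) (S *m a)).
  by rewrite wE mulrA -rmorphM mulVf ?gt_eqF // rmorph1 mul1r -scC addrC subrK.
rewrite -[t in leRHS]gtr0_norm // -nrm_scM scC a_le.
apply: nrm_le_positiveD; first exact: positive_ip.
apply: positive_scM; first by rewrite invr_ge0 ltW.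
by apply: positiveD; exact: positive_ip.
Qed.

Lemma nrm_entry_le n (v : 'cV[B]_n) i : nrm (v i 0) <= colnorm v.
Proof.
rewrite colnormE -(ger0_norm (nrm_ge0 (v i 0))) -sqrtr_sqr ler_sqrt ?nrm_ge0 //.
rewrite -nrm_starM /ip (bigD1 i) //=; apply: nrm_le_positiveD.
  exact: positive_starM.
by apply: positive_sum => j _; exact: positive_starM.
Qed.

Lemma nrm_sum I (s : seq I) (F : I -> B) :
  nrm (\sum_(i <- s) F i) <= \sum_(i <- s) nrm (F i).
Proof.
elim: s => [|i s IHs]; first by rewrite !big_nil nrm0.
by rewrite !big_cons (le_trans (nrmD _ _)) // lerD2l.
Qed.

Lemma mxnorm_has_sup m n (X : 'M[B]_(m, n)) :
  has_sup [set colnorm (X *m v) | v in [set v : 'cV[B]_n | colnorm v <= 1]].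
Proof.
split.
  exists (colnorm (X *m 0)); exists 0 => //=.
  rewrite colnormE /ip big1 ?nrm0 ?sqrtr0 // => i _.
  by rewrite mxE mulr0.
exists (Num.sqrt (\sum_i (\sum_j nrm (X i j)) ^+ 2)) => _ [v /= v1 <-].
rewrite colnormE ler_sqrt; last by apply: sumr_ge0 => i _; exact: sqr_ge0.
rewrite (le_trans (nrm_sum _ _)) //; apply: ler_sum => i _.
rewrite nrm_starM lerXn2r ?nnegrE ?nrm_ge0 ?sumr_ge0 // => [j _|].
  exact: nrm_ge0.
rewrite mxE (le_trans (nrm_sum _ _)) //; apply: ler_sum => j _.
rewrite (le_trans (nrmM _ _)) // ler_piMr ?nrm_ge0 //.
exact: le_trans (nrm_entry_le v j) v1.
Qed.

Lemma colnorm_mulmx_le m n (X : 'M[B]_(m, n)) v :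
  colnorm v <= 1 -> colnorm (X *m v) <= mxnorm X.
Proof.
by move=> v1; apply: sup_upper_bound; [exact: mxnorm_has_sup | exists v].
Qed.

Lemma mxnorm_le m n (X : 'M[B]_(m, n)) r :
  (forall v, colnorm v <= 1 -> colnorm (X *m v) <= r) -> mxnorm X <= r.
Proof.
move=> Xr; apply: ge_sup; first by have [] := mxnorm_has_sup X.
by move=> _ [v /= v1 <-]; exact: Xr.
Qed.

Lemma colnorm_le n (v : 'cV[B]_n) r : 0 <= r ->
  (colnorm v <= r) = (nrm (ip v v) <= r ^+ 2).
Proof.
move=> r0; rewrite colnormE -{1}(ger0_norm r0) -sqrtr_sqr ler_sqrt //.
exact: sqr_ge0.
Qed.

(** The converse of [nrm_ip_mulmx], tested on the normalised adjoint of
    the row. *)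
Lemma mxnorm_row_ge n (r : 'M[B]_(1, n)) :
  nrm ((r *m adjmx r) 0 0) <= mxnorm r ^+ 2.
Proof.
set g := (r *m adjmx r) 0 0; have [->|g0] := eqVneq (nrm g) 0.
  exact: sqr_ge0.
have gt0 : 0 < nrm g by rewrite lt_neqAle eq_sym g0 nrm_ge0.
have gE : ip (adjmx r) (adjmx r) = g.
  by rewrite /ip /g mxE; apply: eq_bigr => i _; rewrite !mxE starK.
have gsa : star g = g by rewrite -gE star_ip.
pose q := (Num.sqrt (nrm g))^-1; pose v := sc q *: adjmx r.
have q2 : q ^+ 2 = (nrm g)^-1 by rewrite exprVn sqr_sqrtr ?ltW.
have q0 : 0 <= q by rewrite invr_ge0 sqrtr_ge0.
have v1 : colnorm v <= 1.
  rewrite colnorm_le // ipZl ipZr gE mulrA -rmorphM -expr2 q2 nrm_scM.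
  by rewrite gtr0_norm ?invr_gt0 // mulVf // expr1n.
have := colnorm_mulmx_le r v1.
have rv : (r *m v) 0 0 = sc q * g by rewrite mulmx_scZ mxE.
have r0 : 0 <= mxnorm r := le_trans (sqrtr_ge0 _) (colnorm_mulmx_le r v1).
rewrite colnorm_le // /ip big_ord1 rv nrm_starM nrm_scM ger0_norm // exprMn q2.
by rewrite expr2 mulrA mulVf // mul1r.
Qed.

End HilbertModule.

(** * Matrices with two rows and orthogonality *)

Section TheTwoRows.
Variables (R : realType) (B : cstarAlgebra R).
Implicit Types (b x y z : B).
Local Notation sc := (@cstar_real R B).

Definition lower_row x z b : 'M[B]_(1, 4) :=
  mx_of_rows 1 4 [:: [:: 2%:R; x; z; b]].

Definition two_rows x y z b : 'M[B]_(2, 4) :=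
  mx_of_rows 2 4 [:: [:: 0; y; 1; 0]; [:: 2%:R; x; z; b]].

Definition lower_gram x z b : B :=
  sc 4 + x * star x + z * star z + b * star b.

Lemma sc2 : sc 2 = 2%:R.
Proof. by rewrite -[2 in LHS]/(1 *+ 2) rmorphMn rmorph1. Qed.

Lemma lower_row_gram x z b :
  lower_row x z b *m adjmx (lower_row x z b) = (lower_gram x z b)%:M.
Proof.
apply/matrixP => i j; rewrite !ord1 !mxE !big_ord_recl big_ord0 !mxE /=.
rewrite -sc2 star_sc -rmorphM -natrM addr0 !addrA //.
Qed.

Lemma two_rows_gram x y z b :
  two_rows x y z b *m adjmx (two_rows x y z b) =
  mx_of_rows 2 2 [:: [:: y * star y + 1; y * star x + star z];
                     [:: x * star y + z; lower_gram x z b]].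
Proof.
apply/matrixP => -[[|[|//]] i] -[[|[|//]] j];
  rewrite !mxE !big_ord_recl big_ord0 !mxE /=.
- by rewrite star0 star1 !mulr0 mul1r add0r !addr0.
- by rewrite !mul0r mul1r add0r !addr0.
- by rewrite star0 star1 !mulr0 mulr1 add0r !addr0.
- by rewrite -sc2 star_sc -rmorphM -natrM addr0 !addrA.
Qed.

Lemma ip_two_rows x y z b v :
  ip (two_rows x y z b *m v) (two_rows x y z b *m v) =
  star ((two_rows x y z b *m v) 0 0) * (two_rows x y z b *m v) 0 0 +
  ip (lower_row x z b *m v) (lower_row x z b *m v).
Proof.
rewrite {1}/ip big_ord_recl; congr (_ + _); rewrite /ip !big_ord1.
have -> : (two_rows x y z b *m v) (lift ord0 ord0) 0
    = (lower_row x z b *m v) 0 0; last by [].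
by rewrite !mxE; apply: eq_bigr => i _; rewrite !mxE.
Qed.

Lemma positive_Mstar x : positive (x * star x).
Proof. by have := positive_starM (star x); rewrite starK. Qed.

(** With z = - x * star y the rows of X are orthogonal, so X * adjmx X is
    diagonal with entries g1 = 1 + y * star y and g, the Gram element of the
    lower row. Since nrm y <= 1, g1 <= 2 <= 4 <= g. This is what the entry 2 is
    for: the upper row never decides the norm. *)
Lemma mxnorm_orthogonal_rows x y b : nrm y <= 1 ->
  mxnorm (two_rows x y (- (x * star y)) b)
    = mxnorm (lower_row x (- (x * star y)) b).
Proof.
move=> y1; set z := - (x * star y); set X := two_rows x y z b.
set r := lower_row x z b.
have ub m n (Y : 'M[B]_(m, n)) v := @colnorm_mulmx_le R B m n Y v.
have norm_ge0 m n (Y : 'M[B]_(m, n)) : 0 <= mxnorm Y.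
  apply: le_trans (sqrtr_ge0 _) (ub _ _ Y 0 _).
  rewrite colnorm_le // /ip big1 ?nrm0 ?expr1n // => i _.
  by rewrite mxE mulr0.
apply/eqP; rewrite eq_le; apply/andP; split; last first.
  apply: mxnorm_le => v /(ub _ _ X); rewrite !colnorm_le // => /(le_trans _).
  apply.
  rewrite ip_two_rows addrC; apply: nrm_le_positiveD; first exact: positive_ip.
  exact: positive_starM.
pose g := lower_gram x z b; pose g1 := y * star y + 1.
have gr : nrm g <= mxnorm r ^+ 2.
  by have := mxnorm_row_ge r; rewrite lower_row_gram mxE mulr1n.
have g1E : star g1 = g1 by rewrite starD starM starK star1.
have gE : star g = g by rewrite !starD !starM !starK star_sc.
have g1g : positive (g - g1).
  have -> : g - g1 = sc 1 - y * star y +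
      (sc 2 + x * star x + z * star z + b * star b).
    apply/eqP; rewrite subr_eq addrACA subrK [_ + 1]addrC -(rmorph1 sc) !addrA.
    by rewrite -!rmorphD (_ : 1 + 1 + 2 = 4) //; ring.
  have sq0 := positive_Mstar.
  apply: positiveD; last by do !apply: positiveD => //; exact: positive_sc.
  apply: positive_scB; first by rewrite starM starK.
  by rewrite nrmM_star expr_le1 // nrm_ge0.
have gp : positive (sc (nrm g) - g) by exact: positive_scB.
have g1p : positive (sc (nrm g) - g1).
  by rewrite -(subrKA g); exact: positiveD.
apply: mxnorm_le => v v1; rewrite colnorm_le //; apply: le_trans gr.
apply/ler_addgt0Pr => e e0.
have t0 : 0 < nrm g + e by rewrite ltr_wpDl ?nrm_ge0.
have [s [sE s2 _]] := positive_sqrt gp e0.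
have [s1 [s1E s12 _]] := positive_sqrt g1p e0.
(* S is a square root of the diagonal matrix t - X * adjmx X; the margin e makes
   both of its entries positive enough to have one. *)
pose S : 'M[B]_2 := mx_of_rows 2 2 [:: [:: s1; 0]; [:: 0; s]].
apply: le_trans (nrm_ip_mulmx (S := S) v t0 _) _.
  rewrite two_rows_gram.
  apply/matrixP => -[[|[|//]] i] -[[|[|//]] j];
    rewrite !mxE !big_ord_recl big_ord0 !mxE /=;
    rewrite ?star0 ?mul0r ?mulr0 ?add0r ?addr0.
  - by rewrite s1E -expr2 s12 rmorphD mulr1n -/g1 addrA [g1 + _]addrC subrK.
  - by rewrite starN starM starK subrr.
  - by rewrite subrr.
  - by rewrite sE -expr2 s2 rmorphD mulr1n -/g addrA [g + _]addrC subrK.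
rewrite ler_piMr ?(ltW t0) //.
by move: v1; rewrite colnorm_le // expr1n.
Qed.

(** Choose b = k so that the lower row r satisfies r * adjmx r = t. Then r has
    norm at most the square root of t, and it stretches adjmx r by exactly that
    factor. If X has no larger norm than r, the upper row must vanish on
    adjmx r, that is, be orthogonal to r. *)
Lemma mxnorm_eq_orthogonal x y z :
  (forall b, mxnorm (two_rows x y z b) = mxnorm (lower_row x z b)) ->
  z = - (x * star y).
Proof.
move=> XrE; pose h := lower_gram x z 0.
have hE : star h = h by rewrite !starD !starM !starK star_sc.
(* The strict gap between t and nrm h makes t - h a square. *)
have hp := positive_scB hE (lexx _).
have [k [kE k2 _]] := positive_sqrt hp ltr01.
pose t := nrm h + 1; have t0 : 0 < t by rewrite ltr_wpDl ?nrm_ge0.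
have gt : lower_gram x z k = sc t.
  have -> : lower_gram x z k = h + k ^+ 2.
    by rewrite /h /lower_gram mul0r addr0 kE expr2.
  by rewrite k2 addrA [h + _]addrC subrK -rmorphD.
pose X := two_rows x y z k; pose r := lower_row x z k.
have r_le : mxnorm r <= Num.sqrt t.
  apply: mxnorm_le => v v1.
  rewrite colnorm_le ?sqrtr_ge0 // sqr_sqrtr ?(ltW t0) //.
  apply: le_trans (nrm_ip_mulmx (S := (0 : 'M[B]_1)) v t0 _) _.
    by rewrite lower_row_gram gt mulmx0 addr0.
  rewrite ler_piMr ?(ltW t0) //.
  by move: v1; rewrite colnorm_le // expr1n.
pose q := (Num.sqrt t)^-1; pose v := sc q *: adjmx r.
have q2 : q ^+ 2 = t^-1 by rewrite exprVn sqr_sqrtr ?ltW.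
have rr : ip (adjmx r) (adjmx r) = sc t.
  have := lower_row_gram x z k; rewrite gt => /matrixP /(_ 0 0).
  rewrite !mxE mulr1n => <-; apply: eq_bigr => i _.
  by rewrite !mxE starK.
have v1 : colnorm v <= 1.
  rewrite colnorm_le // ipZl ipZr rr -!rmorphM mulrA -expr2 q2 mulVf ?gt_eqF //.
  by rewrite rmorph1 expr1n nrm1_le1.
have := colnorm_mulmx_le X v1; rewrite XrE => /le_trans /(_ r_le).
rewrite colnorm_le ?sqrtr_ge0 // sqr_sqrtr ?(ltW t0) // ip_two_rows.
have rv : ip (r *m v) (r *m v) = sc t.
  rewrite mulmx_scZ lower_row_gram gt ipZl ipZr /ip big_ord1 !mxE mulr1n.
  rewrite star_sc -!rmorphM; congr (cstar_real _ _).
  by rewrite mulrA -expr2 q2 mulrA mulVf ?gt_eqF // mul1r.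
pose d := y * star x + star z; pose p := star (sc q * d) * (sc q * d).
have Xv : (X *m v) 0 0 = sc q * d.
  rewrite mulmx_scZ mxE; congr (_ * _).
  rewrite !mxE !big_ord_recl big_ord0 !mxE /=.
  by rewrite !mul0r mul1r add0r !addr0.
rewrite -/X -/r Xv rv -/p => pt.
have p0 : positive p by exact: positive_starM.
have Np0 : positive (- p).
  have -> : - p = sc t - (p + sc t) by rewrite opprD addrCA subrr addr0.
  by apply: positive_scB pt; rewrite starD star_sc positive_sa.
have := nrm_le_positiveD p0 Np0; rewrite subrr nrm0 nrm_starM nrm_scM => d0.
have {}d0 : d = 0.
  apply: nrm0_eq0; have q_gt0 : 0 < q by rewrite invr_gt0 sqrtr_gt0.
  have : (`|q| * nrm d) ^+ 2 = 0 by apply/eqP; rewrite eq_le d0 sqr_ge0.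
  move=> /eqP; rewrite expf_eq0 /= mulf_eq0 normr_eq0 (gt_eqF q_gt0) /=.
  by move/eqP.
have : star d = 0 by rewrite d0 star0.
by rewrite starD starM !starK => /eqP; rewrite addrC addr_eq0 => /eqP.
Qed.

End TheTwoRows.

Theorem theorem6p1 (R : realType) (B : cstarAlgebra R) (A : set B)
    (A_subspace : GRing.submod_closed [in A]) (A_closed : closed A) :
  (forall a b : B, A a -> A b -> A (a * b)) <->
  (forall x y : B, A x -> (@star R B @` A) y -> `|y| <= 1 ->
    exists2 z : B, A z & forall b : B,
      mxnorm (mx_of_rows 2 4 [:: [:: 0; y; 1; 0];
                                 [:: 2%:R; x; z; b]] : 'M[B]_(2, 4))
      = mxnorm (mx_of_rows 1 4 [:: [:: 2%:R; x; z; b]] : 'M[B]_(1, 4))).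
Proof.
have A0 : A 0 by apply/set_mem; exact: A_subspace.1.
have AZD k u v : A u -> A v -> A (k *: u + v).
  by move=> /mem_set Au /mem_set Av; apply/set_mem; exact: A_subspace.2.
have AZ k u : A u -> A (k *: u).
  by move=> Au; rewrite -[_ *: _]addr0; exact: AZD.
split=> [AM x y Ax [a Aa <-] y1|Az a b Aa Ab].
  exists (- (x * star (star a))); last first.
    move=> b; apply: mxnorm_orthogonal_rows.
    by rewrite -lecR -normE.
  by rewrite starK -scaleN1r; apply/AZ/AM.
(* The hypothesis concerns contractions y, so b has to be scaled down. *)
pose c := nrm b + 1; have c0 : 0 < c by rewrite ltr_wpDl ?nrm_ge0.
pose y := star (cstar_real B c^-1 * b).
have [||z Az' /mxnorm_eq_orthogonal zE] := Az a y Aa.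
- by exists (cstar_real B c^-1 * b) => //; rewrite scl; exact: AZ.
- rewrite normE lecR nrm_star nrm_scM gtr0_norm ?invr_gt0 // mulrC.
  by rewrite ler_pdivrMr // mul1r lerDl.
have -> : a * b = - (cstar_real B c * z).
  rewrite zE mulrN opprK /y starK !mulrA -(mulrA (cstar_real B c)) -scC.
  by rewrite !mulrA -rmorphM mulfV ?gt_eqF // rmorph1 mul1r.
by rewrite -scaleN1r scl; apply/AZ/AZ.
Qed.
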